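(* Let $0\le\ell<u$, $p>1$, $n\ge2$, and $\boldsymbol\xi:=(\ell,\xi_1,\ldots,\xi_{n-1},u)$ with $\ell<\xi_1<\cdots<\xi_{n-1}<u$. If $\boldsymbol\xi$ satisfies $\nabla\operatorname{vol}(\breve{U}^*_p(\boldsymbol\xi))=0$, then $\nabla^2\operatorname{vol}(\breve{U}^*_p(\boldsymbol\xi))$ is positive definite.
   Context: Let $f(x):=x^p$ on $[\ell,u]$. Write $\xi_0:=\ell$, $\xi_n:=u$, put $\tau_0:=\ell$, $\tau_{n+1}:=u$ and, for $i=1,\ldots,n$, $$\tau_i:=\frac{[f(\xi_i)-f'(\xi_i)\xi_i]-[f(\xi_{i-1})-f'(\xi_{i-1})\xi_{i-1}]}{f'(\xi_{i-1})-f'(\xi_i)},$$ the abscissa of the intersection of the tangent lines to $f$ at $\xi_{i-1}$ and $\xi_i$. Let $g:[\ell,u]\to\mathbb{R}$ be the piecewise-linear function whose graph connects, in order, $(\ell,f(\ell))$, the points $(\tau_i,\ f(\xi_i)+f'(\xi_i)(\tau_i-\xi_i))$ for $i=1,\ldots,n$, and $(u,f(u))$. With $s:=\frac{f(u)-f(\ell)}{u-\ell}$, the set $\breve{U}^*_p(\boldsymbol\xi)$ is the closure of the convex hull of $$\left\{(x,y,z)\in\mathbb{R}^3:\ (f(\ell)-s\ell)z+sx\ge y\ge z\,g(x/z),\ uz\ge x\ge \ell z,\ 1\ge z>0,\ y\ge 0\right\}.$$ $\operatorname{vol}$ denotes 3-dimensional volume. The gradient and Hessian are taken with respect to the variables $(\xi_1,\ldots,\xi_{n-1})$,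 with $\ell,u,p$ fixed. *)

(* Defs.v *)
From HB Require Import structures.
From mathcomp Require Import all_boot all_order all_algebra.
From mathcomp Require Import all_classical all_reals all_analysis.

Set Implicit Arguments.
Unset Strict Implicit.
Unset Printing Implicit Defensive.

Import Order.TTheory GRing.Theory Num.Theory.
Import numFieldNormedType.Exports.

Local Open Scope classical_set_scope.
Local Open Scope ring_scope.

Section PiecewiseLinear.
Context {R : realType}.
Implicit Types (p l u x : R) (n i : nat).

Definition fpow p x : R := x `^ p.

(* The derivative of fpow on [0, +oo[. It is written in closed form because
   at x = 0 only the one-sided derivative (equal to 0 when p > 1) makes sense,
   powR being extended to negative bases in an ad hoc way. *)
Definition dfpow p x : R := p * x `^ (p - 1).

Lemma is_derive_fpow p x : 0 < x -> is_derive x 1 (fpow p) (dfpow p x).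
Proof. exact: is_derive1_powR. Qed.

(* xi holds the n - 1 free points: knot 0 = l, knot i = xi_i for 0 < i < n
   (entry i - 1 of the row vector), and knot i = u from i = n on. *)
Definition knot l u n (xi : 'rV[R]_n.-1) i : R :=
  nth u (l :: [seq xi 0 j | j <- enum 'I_n.-1]) i.

Definition tangent_icpt p l u n (xi : 'rV[R]_n.-1) i : R :=
  fpow p (knot l u xi i) - dfpow p (knot l u xi i) * knot l u xi i.

Definition tau p l u n (xi : 'rV[R]_n.-1) i : R :=
  if i == 0%N then l
  else if (i <= n)%N then
    (tangent_icpt p l u xi i - tangent_icpt p l u xi i.-1) /
    (dfpow p (knot l u xi i.-1) - dfpow p (knot l u xi i))
  else u.

Definition tau_ord p l u n (xi : 'rV[R]_n.-1) i : R :=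
  if i == 0%N then fpow p l
  else if (i <= n)%N then
    fpow p (knot l u xi i) +
    dfpow p (knot l u xi i) * (tau p l u xi i - knot l u xi i)
  else fpow p u.

(* i is the least index with x <= tau (i + 1), or n if there is none below n:
   the piece [tau i, tau (i + 1)] that contains x. *)
Definition gpl p l u n (xi : 'rV[R]_n.-1) x : R :=
  let t := tau p l u xi in
  let w := tau_ord p l u xi in
  let i := find (fun j => x <= t j.+1) (iota 0 n) in
  w i + (w i.+1 - w i) / (t i.+1 - t i) * (x - t i).

End PiecewiseLinear.

Section Relaxation.
Context {R : realType}.

Definition conv_hull (M : lmodType R) (A : set M) : set M :=
  smallest (@convex_set R M) A.

Definition secant_slope (p l u : R) : R := (fpow p u - fpow p l) / (u - l).

(* The points of R^3 are the triples ((x, y), z). *)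
Definition persp_set (p l u : R) n (xi : 'rV[R]_n.-1) : set (R^o * R^o * R^o) :=
  [set v | let: (x, y, z) := v in
    let s := secant_slope p l u in
    [/\ z * gpl p l u xi (x / z) <= y <= (fpow p l - s * l) * z + s * x,
        l * z <= x <= u * z, 0 < z <= 1 & 0 <= y]].

Definition breveU (p l u : R) n (xi : 'rV[R]_n.-1) : set (R^o * R^o * R^o) :=
  closure (conv_hull (persp_set p l u xi)).

Definition vol3 (A : set (R * R * R)) : R :=
  fine (((@lebesgue_measure R \x @lebesgue_measure R)
          \x @lebesgue_measure R)%E A).

Definition vol_breveU (p l u : R) n (xi : 'rV[R]_n.-1) : R :=
  vol3 (breveU p l u xi).

End Relaxation.

Section SecondOrder.
Context {R : realType} {m : nat}.
Implicit Types (F : 'rV[R]_m -> R) (x : 'rV[R]_m).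

Definition gradient F x : 'rV[R]_m := \row_i 'D_'e_i F x.

Definition hessian F x : 'M[R]_m :=
  \matrix_(i, j) 'D_'e_i (fun y => 'D_'e_j F y) x.

(* 'D is a total operator, so the existence of the derivatives that make up
   the Hessian is a separate condition. *)
Definition twice_differentiable F x : Prop :=
  (\forall y \near x, differentiable F y) /\ differentiable (gradient F) x.

Definition positive_definite (A : 'M[R]_m) : Prop :=
  A^T = A /\ forall v : 'rV[R]_m, v != 0 -> 0 < (v *m A *m v^T) 0 0.

End SecondOrder.

(* Main.v *)
Require Import Defs.
From HB Require Import structures.
From mathcomp Require Import all_boot all_order all_algebra.
From mathcomp Require Import all_classical all_reals all_analysis.
From mathcomp Require Import measurable_realfun ring lra.

Set Implicit Arguments.
Unset Strict Implicit.
Unset Printing Implicit Defensive.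

Import Order.TTheory GRing.Theory Num.Theory.
Import numFieldNormedType.Exports.
Local Open Scope classical_set_scope.
Local Open Scope ring_scope.

(** Why the theorem holds.

    Write f for the power function, k_0 = l < k_1 < ... < k_n = u for the
    knots, T_i for the tangent at k_i and t_i for the abscissa where T_(i-1)
    meets T_i.  Slopes of tangents increase with i, so g is the maximum of the
    T_i on [l, u] ([gpl_le]).  Hence the perspective set is cut out by linear
    inequalities: it is convex, and its closed convex hull adds at most the apex
    of the cone ([breveU_sub]).  The slice at height z is z times the slice at
    height 1, so the volume is a third of the area between the secant and g
    ([vol_breveU_base_area]).  Summation by parts turns this area into a smooth
    function of the knots ([vol_breveUE]):
    vol = cst - 1/6 * sum_i (f' k_i - f' k_(i-1)) * t_i ^ 2.

    Differentiating, the j-th partial derivative is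
    -1/6 * f'' k_j * (t_(j+1) - t_j) * (t_(j+1) + t_j - 2 k_j)
    ([partial_vol]), so a critical point is one where every free knot is the
    midpoint of t_j and t_(j+1).  There only the last factor contributes to the
    second derivatives, and one finds, with w_j = f'' k_j * (k_j - t_j) and
    D_i = f' k_i - f' k_(i-1),
    3 * v H v^T = 2 * sum_j w_j * v_j ^ 2 - sum_i D_i * (dt_i v) ^ 2
    ([hess_formE]), where D_i * dt_i v = w_(i-1) * v_(i-1) + w_i * v_i and the
    end terms are absent.

    Positivity comes from homogeneity.  Each t_i has degree 1 in the pair
    (k_(i-1), k_i), because f is a power; Euler's relation ([isec_euler]) says
    a_i + b_i = t_i * D_i for the weights a_i = f'' k_(i-1) * k_(i-1) *
    (t_i - k_(i-1)) and b_i = f'' k_i * k_i * (k_i - t_i), which are positive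
    except that a_1 = 0 if l = 0.  Writing v_i = k_i * s_i
    with s_0 = s_n = 0, the identity
    (a + b) * (a * s ^ 2 + b * s' ^ 2) - (a * s + b * s') ^ 2
    = a * b * (s - s') ^ 2
    and the midpoint condition give
    3 * v H v^T = sum_i a_i * b_i * (s_(i-1) - s_i) ^ 2 / D_i
    ([hess_form_sum_squares]).  The terms with i > 1 vanish only if s is constant
    from index 1 to n, that is, since s_n = 0, only for v = 0. *)

(** * The power function and the intersection of its tangents *)

Section PowerFunction.
Context {R : realType}.
Variable p : R.
Hypothesis p1 : 1 < p.
Implicit Types x a b : R.

Definition d2fpow (p x : R) : R := p * (p - 1) * x `^ (p - 2).

Let p0 : 0 < p. Proof. by rewrite (lt_trans _ p1). Qed.
Let pB1 : 0 < p - 1. Proof. by rewrite subr_gt0. Qed.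

Lemma fpow_ge0 x : 0 <= fpow p x.
Proof. exact: powR_ge0. Qed.

Lemma dfpow_ge0 x : 0 <= dfpow p x.
Proof. by rewrite /dfpow mulr_ge0 ?powR_ge0// ltW. Qed.

Lemma d2fpow_gt0 x : 0 < x -> 0 < d2fpow p x.
Proof. by move=> x0; rewrite /d2fpow !mulr_gt0// powR_gt0. Qed.

Lemma dfpow_mul x : 0 <= x -> dfpow p x * x = p * fpow p x.
Proof. by move=> x0; rewrite /dfpow -mulrA [_ * x]mulrC mulr_powRB1. Qed.

Lemma d2fpow_mul x : 0 <= x -> d2fpow p x * x = (p - 1) * dfpow p x.
Proof.
move=> x0; rewrite /d2fpow /dfpow -(mulr_powRB1 x0 pB1).
by rewrite (_ : p - 1 - 1 = p - 2); ring.
Qed.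

Lemma dfpow_lt a b : 0 <= a -> a < b -> dfpow p a < dfpow p b.
Proof.
move=> a0 ab; rewrite /dfpow ltr_pM2l//.
by apply: gt0_ltr_powR; rewrite ?nnegrE//; lra.
Qed.

Lemma is_derive_dfpow x : 0 < x -> is_derive x 1 (dfpow p) (d2fpow p x).
Proof.
move=> x0.
have h : is_derive x 1 (@powR R^~ (p - 1)) ((p - 1) * x `^ (p - 1 - 1)).
  exact: is_derive1_powR.
have -> : dfpow p = p \*: @powR R^~ (p - 1) by [].
have -> : d2fpow p x = p *: ((p - 1) * x `^ (p - 1 - 1)).
  rewrite /d2fpow (_ : p - 1 - 1 = p - 2); last by ring.
  by rewrite [RHS]mulrA.
exact: (@is_deriveZ R R R).
Qed.

(** Strict convexity of the power function, in the form of the two strict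
    tangent inequalities.  At a = 0, where f and f' vanish, a direct computation
    avoids the point at which powR is not continuous from the left. *)
Lemma fpow_tangent_lt a b : 0 <= a -> a < b ->
  dfpow p a * (b - a) < fpow p b - fpow p a < dfpow p b * (b - a).
Proof.
rewrite le_eqVlt => /predU1P[<-|a0] ab.
  have fb : 0 < fpow p b by rewrite powR_gt0.
  rewrite !subr0 dfpow_mul ?(ltW ab)// /dfpow /fpow !powR0 ?gt_eqF//.
  by rewrite mulr0 mul0r subr0 fb/= -[ltLHS]mul1r ltr_pM2r.
have pos x : x \in `[a, b] -> 0 < x.
  by rewrite in_itv/= => /andP[ax _]; exact: lt_le_trans ax.
have [c|c|c] := @MVT R (fpow p) (dfpow p) a b ab.
- by move=> cab; apply/is_derive_fpow/pos/subset_itv_oo_cc.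
- apply: derivable_within_continuous => x xab.
  by have [] := is_derive_fpow p (pos _ xab).
rewrite in_itv/= => /andP[ac cb] ->.
by rewrite !ltr_pM2r ?subr_gt0// !dfpow_lt// ltW// (lt_trans a0).
Qed.

End PowerFunction.

Section TangentIntersection.
Context {R : realType}.
Variable p : R.
Hypothesis p1 : 1 < p.
Implicit Types a b : R.

(** The abscissa where the tangents at a and b meet; the intercepts simplify
    by f a - f' a * a = (1 - p) * f a. *)
Definition isec (p a b : R) : R :=
  (p - 1) * (fpow p b - fpow p a) / (dfpow p b - dfpow p a).

Lemma isecM a b : 0 <= a -> a < b ->
  isec p a b * (dfpow p b - dfpow p a) = (p - 1) * (fpow p b - fpow p a).
Proof.
by move=> a0 ab; rewrite /isec divfK// subr_eq0 gt_eqF// dfpow_lt.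
Qed.

Lemma isec_between a b : 0 <= a -> a < b -> a < isec p a b < b.
Proof.
move=> a0 ab; have D : 0 < dfpow p b - dfpow p a by rewrite subr_gt0 dfpow_lt.
have /andP[h1 h2] := fpow_tangent_lt p1 a0 ab.
have b0 : 0 <= b by rewrite ltW// (le_lt_trans a0).
have Ea := dfpow_mul p1 a0; have Eb := dfpow_mul p1 b0.
rewrite /isec ltr_pdivlMr// ltr_pdivrMr//; apply/andP; split; lra.
Qed.

(** Homogeneity: the intersection abscissa has degree 1 in (a, b), and this is
    Euler's relation for it. *)
Lemma isec_euler a b : 0 <= a -> a < b ->
  d2fpow p a * a * (isec p a b - a) + d2fpow p b * b * (b - isec p a b) =
  isec p a b * (dfpow p b - dfpow p a).
Proof.
move=> a0 ab; have b0 : 0 <= b by rewrite ltW// (le_lt_trans a0).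
have E := isecM a0 ab.
have Ea := dfpow_mul p1 a0; have Eb := dfpow_mul p1 b0.
rewrite !d2fpow_mul//; set t := isec p a b in E *.
transitivity ((p - 1) * (dfpow p b * b - dfpow p a * a -
  t * (dfpow p b - dfpow p a))); first by ring.
by rewrite E Ea Eb; ring.
Qed.

End TangentIntersection.

(** * The piecewise linear function as a maximum of tangents *)

Section Knots.
Context {R : realType}.
Variables (p l u : R) (n : nat) (xi : 'rV[R]_n.-1).
Hypothesis n0 : (0 < n)%N.
Local Notation k := (knot l u xi).
Local Notation t := (tau p l u xi).

Lemma knot0 : k 0 = l.
Proof. by []. Qed.

Lemma knot_out i : (n <= i)%N -> k i = u.
Proof.
move=> ni; rewrite /knot nth_default//= size_map size_enum_ord.
by rewrite prednK.
Qed.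

Lemma knot_coord (i : 'I_n.-1) : k i.+1 = xi 0 i.
Proof.
rewrite /knot /= (nth_map i) ?size_enum_ord//.
by congr (xi 0 _); apply: val_inj; rewrite /= nth_enum_ord.
Qed.

Lemma tau0 : t 0 = l.
Proof. by []. Qed.

Lemma tau_out i : (n < i)%N -> t i = u.
Proof. by case: i => // i ni; rewrite /tau /= leqNgt ni. Qed.

Hypotheses (p1 : 1 < p) (l0 : 0 <= l).
Hypothesis kS : forall i, (i < n)%N -> k i < k i.+1.

Lemma knot_ge0 i : (i <= n)%N -> 0 <= k i.
Proof.
elim: i => [_|i ih ni]; first by rewrite knot0.
by rewrite ltW// (le_lt_trans (ih (ltnW ni)))// kS.
Qed.

Lemma knot_gt0 i : (0 < i <= n)%N -> 0 < k i.
Proof.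
by case: i => // i /= ni; rewrite (le_lt_trans (knot_ge0 (ltnW ni)))// kS.
Qed.

Lemma tangent_icptE i : (i <= n)%N ->
  tangent_icpt p l u xi i = (1 - p) * fpow p (k i).
Proof. by move=> ni; rewrite /tangent_icpt dfpow_mul ?knot_ge0//; ring. Qed.

Lemma tauS i : (i < n)%N -> t i.+1 = isec p (k i) (k i.+1).
Proof.
move=> ni; rewrite /tau /= ni !tangent_icptE// ?(ltnW ni)// /isec.
have D : dfpow p (k i.+1) - dfpow p (k i) != 0.
  by rewrite subr_eq0 gt_eqF// dfpow_lt ?kS ?knot_ge0// ltnW.
by field; rewrite D -oppr_eq0 opprB D.
Qed.

Lemma tau_between i : (i < n)%N -> k i < t i.+1 < k i.+1.
Proof.
move=> ni; rewrite tauS//.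
by apply: isec_between => //; [exact/knot_ge0/ltnW|exact: kS].
Qed.

Lemma tau_ltS i : (i <= n)%N -> t i < t i.+1.
Proof.
case: i => [_|i ni]; first by have /andP[] := tau_between n0.
have /andP[_ h] := tau_between ni; apply: (lt_le_trans h).
have [ni1|ni1] := ltnP i.+1 n; last by rewrite tau_out// knot_out.
by have /andP[/ltW] := tau_between ni1.
Qed.

Lemma tau_le i j : (i <= j)%N -> (j <= n.+1)%N -> t i <= t j.
Proof.
elim: j => [|j ih]; first by rewrite leqn0 => /eqP->.
rewrite leq_eqVlt => /predU1P[->//|ij] jn.
exact: le_trans (ih ij (ltnW jn)) (ltW (tau_ltS _)).
Qed.

Definition tangent i x := tangent_icpt p l u xi i + dfpow p (k i) * x.

Lemma tangent_diff i x : (i < n)%N ->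
  tangent i.+1 x - tangent i x =
  (dfpow p (k i.+1) - dfpow p (k i)) * (x - t i.+1).
Proof.
move=> ni; rewrite mulrBr [X in _ = _ - X]mulrC tauS//.
rewrite isecM ?kS ?knot_ge0 ?(ltnW ni)//.
by rewrite /tangent !tangent_icptE ?(ltnW ni)//; ring.
Qed.

Lemma tangent_slope_gt0 i : (i < n)%N -> 0 < dfpow p (k i.+1) - dfpow p (k i).
Proof. by move=> ni; rewrite subr_gt0 dfpow_lt ?kS ?knot_ge0// ltnW. Qed.

Lemma tangent_le_left i j x : (i <= j)%N -> (j <= n)%N -> t j <= x ->
  tangent i x <= tangent j x.
Proof.
elim: j => [|j ih]; first by rewrite leqn0 => /eqP->.
rewrite leq_eqVlt => /predU1P[->//|ij] jn jx.
apply: (le_trans (ih ij (ltnW jn) _)).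
  by apply: le_trans jx; apply: tau_le => //; exact: leqW.
rewrite -subr_ge0 tangent_diff// mulr_ge0 ?subr_ge0//.
by rewrite -subr_ge0 ltW// tangent_slope_gt0.
Qed.

Lemma tangent_le_right i j x : (i <= j)%N -> (j <= n)%N -> x <= t i.+1 ->
  tangent j x <= tangent i x.
Proof.
move=> + + xi1; elim: j => [|j ih]; first by rewrite leqn0 => /eqP->.
rewrite leq_eqVlt => /predU1P[->//|ij] jn.
apply: le_trans (ih ij (ltnW jn)).
rewrite -subr_le0 tangent_diff// mulr_ge0_le0 ?subr_le0//.
  by rewrite ltW// tangent_slope_gt0.
by apply: (le_trans xi1); apply: tau_le => //; exact: leqW.
Qed.

(** The slopes of the tangents increase with the index and consecutive tangents
    cross at the points tau, so the tangent in force on a piece dominates all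
    the others there. *)
Lemma tangent_max i j x : (i <= n)%N -> (j <= n)%N -> t j <= x <= t j.+1 ->
  tangent i x <= tangent j x.
Proof.
move=> ni nj /andP[jx xj]; have [ij|/ltnW ji] := leqP i j.
  exact: tangent_le_left.
exact: tangent_le_right.
Qed.

Lemma tau_ordE i : (i <= n)%N -> tau_ord p l u xi i = tangent i (t i).
Proof.
rewrite /tau_ord /tangent /tangent_icpt; case: i => [|i] /= ni.
  by rewrite tau0 knot0; ring.
by rewrite ni; ring.
Qed.

Lemma tau_ordSE i : (i <= n)%N -> tau_ord p l u xi i.+1 = tangent i (t i.+1).
Proof.
move=> _; have [ni|ni] := ltnP i n; last first.
  rewrite /tau_ord /= ltnNge ni/= tau_out//.
  by rewrite /tangent /tangent_icpt !knot_out//; ring.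
rewrite tau_ordE//; apply/eqP; rewrite -subr_eq0 tangent_diff//.
by rewrite subrr mulr0.
Qed.

(** The computed index of the piece is correct on all of [l, u]: the search
    runs over the right ends of the pieces 0, ..., n - 1 only, and it returns
    n, the index of the last piece, when it fails. *)
Lemma piece_exists x : l <= x <= u -> exists2 i, (i <= n)%N &
  gpl p l u xi x = tangent i x /\ t i <= x <= t i.+1.
Proof.
move=> /andP[lx xu]; rewrite /gpl.
set a := (fun j => x <= t j.+1); set i := find a (iota 0 n).
have ni : (i <= n)%N by rewrite -[leqRHS](size_iota 0) find_size.
have ix : t i <= x.
  case E : i => [|j] //.
  have ji : (j < i)%N by rewrite E.
  have := before_find 0%N ji.
  by rewrite nth_iota ?(leq_trans ji)// add0n /a => /negbT; rewrite -ltNge => /ltW.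
have xi1 : x <= t i.+1.
  have [nii|nii] := ltnP i n; last by rewrite tau_out.
  have : has a (iota 0 n) by rewrite has_find size_iota.
  by move=> /(nth_find 0%N); rewrite nth_iota.
exists i => //; split; last by rewrite ix.
rewrite tau_ordSE// tau_ordE// /tangent.
have := tau_ltS ni; rewrite -subr_gt0 => h; field; rewrite gt_eqF//=.
Qed.

Lemma gpl_tangent i x : (i <= n)%N -> t i <= x <= t i.+1 ->
  gpl p l u xi x = tangent i x.
Proof.
move=> ni ix; have : l <= x <= u.
  have /andP[h1 h2] := ix; apply/andP; split.
    exact: le_trans (tau_le (leq0n i) (leqW ni)) h1.
  by apply: (le_trans h2); rewrite -[leRHS](tau_out (ltnSn n)) tau_le.
move=> /piece_exists[j nj [-> jx]].
by apply/eqP; rewrite eq_le !tangent_max.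
Qed.

(** On [l, u] the epigraph of the piecewise linear function is polyhedral. *)
Lemma gpl_le x y : l <= x <= u ->
  gpl p l u xi x <= y <-> forall i, (i <= n)%N -> tangent i x <= y.
Proof.
move=> xlu; have [j nj [-> jx]] := piece_exists xlu; split.
  by move=> xy i ni; rewrite (le_trans _ xy)// tangent_max.
by move=> /(_ _ nj).
Qed.

Lemma gpl_ge0 x : l <= x <= u -> 0 <= gpl p l u xi x.
Proof.
move=> /[dup] /andP[lx _] xlu.
have := (gpl_le (gpl p l u xi x) xlu).1 (lexx _) 0%N (leq0n n).
apply: le_trans; rewrite /tangent /tangent_icpt knot0.
rewrite -addrA -mulrN -mulrDr addr_ge0 ?fpow_ge0//.
by rewrite mulr_ge0 ?dfpow_ge0//; lra.
Qed.

Lemma tangent_le_fpow i x : (i <= n)%N -> 0 <= x -> tangent i x <= fpow p x.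
Proof.
move=> ni x0; rewrite /tangent /tangent_icpt; have ki := knot_ge0 ni.
have [ix|xi'|->] := ltgtP (k i) x.
- have /andP[] := fpow_tangent_lt p1 ki ix; lra.
- have /andP[] := fpow_tangent_lt p1 x0 xi'; lra.
- lra.
Qed.

(** A tangent lies below the power function at l and at u, hence below the
    secant in between. *)
Lemma gpl_le_secant x : l < u -> l <= x <= u ->
  gpl p l u xi x <= fpow p l - secant_slope p l u * l + secant_slope p l u * x.
Proof.
move=> lu xlu; apply/gpl_le => // i ni.
have u0 : 0 <= u by rewrite (le_trans l0)// ltW.
have := tangent_le_fpow ni l0; have := tangent_le_fpow ni u0.
rewrite /tangent; set c := tangent_icpt _ _ _ _ _; set d := dfpow _ _.
have E : secant_slope p l u * (u - l) = fpow p u - fpow p l.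
  by rewrite /secant_slope divfK// subr_eq0 gt_eqF.
move: E xlu; set s := secant_slope _ _ _ => E /andP[lx xu] hu hl.
(* Both sides are affine: compare them at l and u with the weights u - x and
   x - l. *)
rewrite -(ler_pM2l (_ : 0 < u - l)) ?subr_gt0//.
rewrite [leRHS](_ : _ = (fpow p l) * (u - x) + fpow p u * (x - l)); last first.
  rewrite (_ : fpow p u = fpow p l + s * (u - l)); first by ring.
  by rewrite E; ring.
rewrite [leLHS](_ : _ = (c + d * l) * (u - x) + (c + d * u) * (x - l));
  last by ring.
by rewrite lerD// ler_wpM2r// subr_ge0.
Qed.

End Knots.

(** * Areas and volumes *)

Section Volume.
Context {R : realType}.
Local Notation mu := (@lebesgue_measure R).
Implicit Types (a b c d : R).

Lemma area_between a b (lo hi : R -> R) :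
  (forall x, a <= x <= b -> lo x <= hi x) ->
  (mu \x mu)%E [set v | a <= v.1 <= b /\ lo v.1 <= v.2 <= hi v.1] =
  (\int[mu]_(x in `[a, b]) (hi x - lo x)%:E)%E.
Proof.
move=> lohi; rewrite /product_measure1 [RHS]integral_mkcond.
apply: eq_integral => x _ /=; rewrite patchE.
have [xab|xab] := boolP (x \in `[a, b]%classic).
  move: (xab); rewrite inE/= in_itv/= => xab'.
  rewrite (_ : xsection _ _ = `[lo x, hi x]%classic); last first.
    apply/seteqP; split => y; rewrite /xsection/= inE/= in_itv/=; first by case.
    by split.
  rewrite lebesgue_measure_itv/= lte_fin; case: ltP => // h.
  by rewrite (_ : hi x = lo x) ?subrr//; apply/eqP; rewrite eq_le h lohi.
rewrite (_ : xsection _ _ = set0) ?measure0//.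
apply/seteqP; split => y //; rewrite /xsection/= inE/= => -[h _].
by move: xab; rewrite notin_setE/= in_itv/= h.
Qed.

Lemma integral_linear a b c d : a <= b ->
  (\int[mu]_(x in `[a, b]) (c + d * x)%:E)%E =
  (c * (b - a) + d * (b ^+ 2 - a ^+ 2) / 2)%:E.
Proof.
rewrite le_eqVlt => /predU1P[<-|ab].
  rewrite set_itv1 integral_set1; congr EFin; ring.
pose F x : R := c * x + d / 2 * x ^+ 2.
have dF x : is_derive x (1 : R) F (c + d * x).
  have -> : F = horner (c *: 'X + (d / 2) *: 'X^2 : {poly R}).
    by apply/funext => y; rewrite /F !hornerE.
  by apply: is_derive_eq; rewrite !poly.derivE !hornerE; field.
have cF : continuous F.
  move=> x; apply: differentiable_continuous; apply/derivable1_diffP.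
  by have [] := dF x.
rewrite (@continuous_FTC2 R (fun x => c + d * x) F a b ab).
- by rewrite -EFinB /F; congr EFin; field.
- apply: continuous_subspaceT => x; apply: cvgD; first exact: cvg_cst.
  by apply: cvgM; [exact: cvg_cst|exact: cvg_id].
- split; first by move=> x _; have [] := dF x.
    exact/cvg_at_right_filter/cF.
  exact/cvg_at_left_filter/cF.
- by move=> x _; rewrite derive1E; have [_ ->] := dF x.
Qed.

Lemma integral_sqr c :
  (\int[mu]_(x in `[0%R, 1%R]) (c * x ^+ 2)%:E)%E = (c / 3)%:E.
Proof.
pose F x : R := c / 3 * x ^+ 3.
have dF x : is_derive x (1 : R) F (c * x ^+ 2).
  have -> : F = horner ((c / 3) *: 'X^3 : {poly R}).
    by apply/funext => y; rewrite /F !hornerE.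
  by apply: is_derive_eq; rewrite derivZ derivXn hornerZ hornerMn hornerXn /=; field.
have cF : continuous F.
  move=> x; apply: differentiable_continuous; apply/derivable1_diffP.
  by have [] := dF x.
rewrite (@continuous_FTC2 R (fun x => c * x ^+ 2) F 0 1 ltr01).
- by rewrite -EFinB /F; congr EFin; field.
- apply: continuous_subspaceT => x; apply: cvgM; first exact: cvg_cst.
  exact: exprn_continuous.
- split; first by move=> x _; have [] := dF x.
    exact/cvg_at_right_filter/cF.
  exact/cvg_at_left_filter/cF.
- by move=> x _; rewrite derive1E; have [_ ->] := dF x.
Qed.

Lemma integral_piecewise_linear (t c d : nat -> R) (h : R -> R) N :
  (forall i, (i < N)%N -> t i <= t i.+1) ->
  (forall i x, (i < N)%N -> t i <= x <= t i.+1 -> h x = c i + d i * x) ->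
  measurable_fun `[t 0%N, t N] h /\
  (\int[mu]_(x in `[t 0%N, t N]) (h x)%:E)%E =
  (\sum_(i < N) (c i * (t i.+1 - t i) + d i * (t i.+1 ^+ 2 - t i ^+ 2) / 2))%:E.
Proof.
elim: N => [|N ih] tS hE.
  rewrite set_itv1 integral_set1 big_ord0; split=> //.
  exact: measurable_fun_set1.
have [|i x iN|mh Ih] := ih; first by move=> i iN; exact/tS/ltnW.
  exact/hE/ltnW.
have t0N : t 0%N <= t N.
  elim: N tS {ih hE mh Ih} => [//|N ih] tS.
  by apply: le_trans (tS _ (ltnW _)) => //; apply: ih => i iN; exact/tS/ltnW.
have tN : t N <= t N.+1 by exact: tS.
have hN x : x \in `]t N, t N.+1] -> h x = c N + d N * x.
  by rewrite in_itv/= => /andP[/ltW tx xt]; apply: hE; rewrite ?tx.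
have mN : measurable_fun `]t N, t N.+1] h.
  apply: (@eq_measurable_fun _ _ _ _ _ (fun x => c N + d N * x)).
    by move=> x; rewrite inE/= => /hN ->.
  apply: measurable_funD; first exact: measurable_cst.
  by apply: measurable_funM; [exact: measurable_cst|exact: measurable_id].
have U : `[t 0%N, t N.+1]%classic = `[t 0%N, t N] `|` `]t N, t N.+1].
  by rewrite (@itv_bndbnd_setU _ _ _ (BRight (t N))).
have mU : measurable_fun (`[t 0%N, t N] `|` `]t N, t N.+1]) h.
  by apply/measurable_funU.
rewrite U; split=> //.
rewrite integral_setU//; last 2 first.
- exact/measurable_EFinP.
- apply/disj_setPS => y [/=]; rewrite 2!in_itv/= => /andP[_ yx] /andP[].
  by rewrite ltNge yx.
rewrite Ih big_ord_recr/= EFinD; congr (_ + _)%E.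
rewrite integral_itv_obnd_cbnd; last exact/measurable_EFinP.
rewrite -integral_linear//; apply: eq_integral => x.
by rewrite inE/= in_itv/= => tx; rewrite (hE N).
Qed.

Lemma product_measure_ysection (d1 d2 : measure_display) (T1 : measurableType d1)
    (T2 : measurableType d2) (m1 : {sigma_finite_measure set T1 -> \bar R})
    (m2 : {sigma_finite_measure set T2 -> \bar R}) (A : set (T1 * T2)) :
  measurable A -> (m1 \x m2)%E A = (\int[m2]_y m1 (ysection A y))%E.
Proof.
move=> mA; rewrite -[RHS]/((m1 \x^ m2)%E A).
by apply: product_measure_unique => // B C mB mC /=; rewrite product_measure2E.
Qed.

(** Supplies the sigma-finite structure with which slices of a product of three
    measures can be taken along the last axis. *)
Lemma product_measure_sigma_finite (d1 d2 : measure_display)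
    (T1 : measurableType d1) (T2 : measurableType d2)
    (m1 : {sigma_finite_measure set T1 -> \bar R})
    (m2 : {sigma_finite_measure set T2 -> \bar R}) :
  sigma_finite setT (m1 \x m2)%E.
Proof.
have /sigma_finiteP[F [TF ndF Foo]] := sigma_finiteT m1.
have /sigma_finiteP[G [TG ndG Goo]] := sigma_finiteT m2.
exists (fun i => F i `*` G i) => [|i].
  rewrite -setXTT TF TG; apply/seteqP; split=> [[x y]/= [[i _ Fx] [j _ Gy]]|].
    exists (maxn i j) => //; split.
    - by move: x Fx; apply/subsetPset/ndF/leq_maxl.
    - by move: y Gy; apply/subsetPset/ndG/leq_maxr.
  by move=> [x y] [i _ []/= Fx Gy]; split; exists i.
have [mF Fy] := Foo i; have [mG Gy] := Goo i.
split; first exact: measurableX.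
by rewrite product_measure1E// lte_mul_pinfty// ge0_fin_numE.
Qed.

(** Cavalieri's principle for a solid whose slices grow like those of a cone. *)
Lemma volume_cone (A : set (R * R * R)) (K : R) : measurable A ->
  (forall z, 0 < z <= 1 -> (mu \x mu)%E (ysection A z) = (K * z ^+ 2)%:E) ->
  (forall z, ~~ (0 < z <= 1) -> ysection A z = set0) ->
  ((mu \x mu) \x mu)%E A = (K / 3)%:E.
Proof.
move=> mA AK A0.
pose sf := Measure_isSigmaFinite.Build _ _ _ (mu \x mu)%E
  (product_measure_sigma_finite mu mu).
pose mu2 : {sigma_finite_measure set _ -> \bar R} := HB.pack (mu \x mu)%E sf.
rewrite [LHS](@product_measure_ysection _ _ _ _ mu2 mu A mA).
rewrite -integral_sqr -integral_itv_obnd_cbnd; last first.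
  apply/measurable_EFinP/measurable_funM => //; exact: measurable_funX.
rewrite [RHS]integral_mkcond; apply: eq_integral => z _ /=.
rewrite patchE; case: ifPn; rewrite ?notin_setE ?inE/= in_itv/=.
  exact: AK.
by move=> /negP h; rewrite A0 ?measure0.
Qed.

End Volume.

(** * The volume of the relaxation *)

Section VolumeOfRelaxation.
Context {R : realType}.
Local Notation mu := (@lebesgue_measure R).

Definition affine (a b c d : R) (v : R * R * R) : R :=
  d + a * v.1.1 + b * v.1.2 + c * v.2.

Lemma affine_continuous a b c d :
  continuous (affine a b c d : R^o * R^o * R^o -> R^o).
Proof.
move=> v; rewrite /affine.
apply: cvgD; last first.
  by apply: cvgM; [exact: cvg_cst|exact: cvg_snd].
apply: cvgD; last first.
  apply: cvgM; first exact: cvg_cst.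
  by apply: cvg_comp; [exact: cvg_fst|exact: cvg_snd].
apply: cvgD; first exact: cvg_cst.
apply: cvgM; first exact: cvg_cst.
by apply: cvg_comp; [exact: cvg_fst|exact: cvg_fst].
Qed.

Lemma affine_measurable a b c d : measurable_fun setT (affine a b c d).
Proof.
have m11 : measurable_fun [set: R * R * R] (fun v => v.1.1).
  exact: measurableT_comp.
have m12 : measurable_fun [set: R * R * R] (fun v => v.1.2).
  exact: measurableT_comp.
rewrite /affine; apply: measurable_funD; last exact: measurable_funM.
apply: measurable_funD; last exact: measurable_funM.
by apply: measurable_funD => //; exact: measurable_funM.
Qed.

Lemma measurable_halfspace a b c d : measurable [set v | 0 <= affine a b c d v].
Proof.
have := @affine_measurable a b c d measurableT _ (measurable_itv `[0, +oo[).
rewrite setTI; congr measurable; apply/seteqP.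
by split=> v /=; rewrite in_itv/= andbT.
Qed.

(** The only way in which the closed convex hull is used: it lies in every
    closed half-space that contains the set. *)
Lemma closure_conv_hull_halfspace (A : set (R^o * R^o * R^o)) a b c d :
  (forall v, A v -> 0 <= affine a b c d v) ->
  forall v, closure (conv_hull A) v -> 0 <= affine a b c d v.
Proof.
move=> AH; pose H : set (R^o * R^o * R^o) := [set v | 0 <= affine a b c d v].
have cH : closed H.
  apply: (preimage_closed (f := affine a b c d)) (@closed_ge _ 0).
  by move=> v _; exact: affine_continuous.
have convH : @convex_set R (R^o * R^o * R^o)%type H.
  move=> v w k; rewrite !inE /H/= => Hv Hw.
  have -> : affine a b c d (conv k v w) =
      k%:num * affine a b c d v + (1 - k%:num) * affine a b c d w.
    rewrite /affine /conv/= /GRing.scale/= /unstable.onem; ring.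
  by rewrite addr_ge0// mulr_ge0// subr_ge0.
suff : closure (conv_hull A) `<=` H by [].
rewrite [X in _ `<=` X](closure_id H).1//; apply: closure_subset.
exact: smallest_sub.
Qed.

Variables (p l u : R) (n : nat) (xi : 'rV[R]_n.-1).
Hypothesis n0 : (0 < n)%N.
Local Notation k := (knot l u xi).
Local Notation t := (tau p l u xi).
Hypotheses (p1 : 1 < p) (l0 : 0 <= l) (lu : l < u).
Hypothesis kS : forall i, (i < n)%N -> k i < k i.+1.

Local Notation s := (secant_slope p l u).
Local Notation persp := (persp_set p l u xi).

(** Since the piecewise linear function is the maximum of the tangents, its
    perspective is a maximum of linear forms. *)
Lemma persp_setE : persp = [set v | 0 < v.2] `&`
  ([set v | 0 <= affine 0 0 (-1) 1 v] `&` [set v | 0 <= affine 0 1 0 0 v] `&`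
   [set v | 0 <= affine 1 0 (- l) 0 v] `&` [set v | 0 <= affine (-1) 0 u 0 v] `&`
   [set v | 0 <= affine s (-1) (fpow p l - s * l) 0 v] `&`
   \bigcap_i [set v | (i <= n)%N ->
     0 <= affine (- dfpow p (k i)) 1 (- tangent_icpt p l u xi i) 0 v]).
Proof.
have scal x y z i : 0 < z -> (tangent p l u xi i (x / z) <= y / z) =
    (0 <= affine (- dfpow p (k i)) 1 (- tangent_icpt p l u xi i) 0 (x, y, z)).
  move=> z0; rewrite ler_pdivlMr// /tangent mulrDl -mulrA divfK ?gt_eqF//.
  by rewrite -subr_ge0 /affine/=; congr (0 <= _); ring.
have dom x z : 0 < z -> l * z <= x <= u * z -> l <= x / z <= u.
  by move=> z0; rewrite ler_pdivlMr// ler_pdivrMr.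
apply/seteqP; split=> [[[x y] z]|[[x y] z]]; rewrite /persp_set/=.
  move=> [/andP[gy yS] xz /andP[z0 z1] y0]; split=> //.
  have /andP[lx xu] := xz.
  split; [split; [split; [split; [split|]|]|]|]; rewrite /= /affine/=; try lra.
  move=> i _ ni; rewrite -scal//; apply: (gpl_le n0 p1 l0 kS _ _).1 => //.
    exact: dom.
  by rewrite ler_pdivlMr// mulrC.
move=> [z0 [[[[[]]]]]]; rewrite /affine/= => z1 y0 lx xu yS ti.
have xz : l * z <= x <= u * z by apply/andP; split; lra.
split=> //; last lra.
- apply/andP; split; last by lra.
  rewrite mulrC -ler_pdivlMr//.
  apply/(gpl_le n0 p1 l0 kS _ (dom _ _ z0 xz)) => i ni.
  by rewrite scal//; exact: ti.
- by rewrite z0/=; lra.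
Qed.

Lemma persp_measurable : measurable (persp : set (R * R * R)).
Proof.
rewrite persp_setE; apply: measurableI.
  have := @affine_measurable 0 0 1 0 measurableT _ (measurable_itv `]0, +oo[).
  rewrite setTI; congr measurable; apply/seteqP.
  by split=> v /=; rewrite in_itv/= andbT /affine !mul0r !add0r mul1r.
apply: measurableI; last first.
  apply: bigcapT_measurable => i; have [ni|ni] := boolP (i <= n)%N.
    rewrite (_ : [set _ | _] = [set v | 0 <= affine (- dfpow p (k i)) 1
      (- tangent_icpt p l u xi i) 0 v]); first exact: measurable_halfspace.
    by apply/seteqP; split=> v /=; [exact|move=> ? _].
  rewrite (_ : [set _ | _] = setT)//.
  by apply/seteqP; split.
do 4?[apply: measurableI; last exact: measurable_halfspace].
exact: measurable_halfspace.
Qed.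

(** The perspective set is already convex; at height 0 the closed inequalities
    leave only the apex of the cone. *)
Lemma breveU_sub : breveU p l u xi `<=` persp `|` [set (0, 0, 0)].
Proof.
move=> v vU.
have H a b c d : (forall v, persp v -> 0 <= affine a b c d v) ->
    0 <= affine a b c d v by move=> h; exact: (closure_conv_hull_halfspace h).
have H0 : 0 <= affine 0 0 1 0 v.
  by apply: H => -[[x y] z] [_ _ /andP[/ltW z0 _] _]; rewrite /affine/=; lra.
have H1 : 0 <= affine 0 0 (-1) 1 v.
  by apply: H => w; rewrite persp_setE => -[_ [[[[[]]]]]].
have H2 : 0 <= affine 0 1 0 0 v.
  by apply: H => w; rewrite persp_setE => -[_ [[[[[]]]]]].
have H3 : 0 <= affine 1 0 (- l) 0 v.
  by apply: H => w; rewrite persp_setE => -[_ [[[[[]]]]]].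
have H4 : 0 <= affine (-1) 0 u 0 v.
  by apply: H => w; rewrite persp_setE => -[_ [[[[[]]]]]].
have H5 : 0 <= affine s (-1) (fpow p l - s * l) 0 v.
  by apply: H => w; rewrite persp_setE => -[_ [[[[[]]]]]].
have H6 i : (i <= n)%N ->
    0 <= affine (- dfpow p (k i)) 1 (- tangent_icpt p l u xi i) 0 v.
  move=> ni; apply: H => w; rewrite persp_setE => -[_ [[[[[]]]]]] _ _ _ _ _.
  by move=> /(_ i I); exact.
have [z0|zle] := ltP 0 v.2.
  by left; rewrite persp_setE; split=> //; split => // i _; exact: H6.
right; move: zle H0 H2 H3 H4 H5; clear; case: v => [[x y] z].
rewrite /affine/= => zle H0 H2 H3 H4 H5.
have z0 : z = 0 by lra.
rewrite z0 in H3 H4 H5; have x0 : x = 0 by lra.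
by rewrite x0 in H5; have y0 : y = 0; [lra|rewrite x0 y0 z0].
Qed.

Lemma ysection_persp z : 0 < z <= 1 ->
  ysection (persp : set (R * R * R)) z = [set v | l * z <= v.1 <= u * z /\
    z * gpl p l u xi (v.1 / z) <= v.2 <= (fpow p l - s * l) * z + s * v.1].
Proof.
move=> z01; apply/seteqP; split=> [[x y]|[x y]]; rewrite /ysection/= inE.
  by case.
move=> [/= xz /andP[gy yS]]; split=> //; first by rewrite gy.
apply: le_trans gy; rewrite mulr_ge0 ?(gpl_ge0 n0 p1 l0 kS)//.
  by case/andP: z01 => /ltW.
by case/andP: z01 => z0 _; rewrite ler_pdivlMr// ler_pdivrMr.
Qed.

(** The area between the secant and the piecewise linear function, one summand
    per piece. *)
Definition base_area : R :=
  \sum_(i < n.+1) (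
    (fpow p l - s * l - tangent_icpt p l u xi i) * (t i.+1 - t i) +
    (s - dfpow p (k i)) * (t i.+1 ^+ 2 - t i ^+ 2) / 2).

Lemma area_ysection_persp z : 0 < z <= 1 ->
  (mu \x mu)%E (ysection (persp : set (R * R * R)) z) = (base_area * z ^+ 2)%:E.
Proof.
move=> z01; rewrite ysection_persp//; have /andP[z0 _] := z01.
have dom x : l * z <= x <= u * z -> l <= x / z <= u.
  by rewrite ler_pdivlMr// ler_pdivrMr.
rewrite (area_between (lo := fun x => z * gpl p l u xi (x / z))
    (hi := fun x => (fpow p l - s * l) * z + s * x)); last first.
  move=> x /dom xz; rewrite mulrC -ler_pdivlMr//.
  apply: (le_trans (gpl_le_secant n0 p1 l0 kS lu xz)).
  by rewrite mulrDl mulfK ?gt_eqF// mulrA.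
have [|i x ni tx|_] := @integral_piecewise_linear R (fun i => t i * z)
  (fun i => (fpow p l - s * l - tangent_icpt p l u xi i) * z)
  (fun i => s - dfpow p (k i))
  (fun x => (fpow p l - s * l) * z + s * x - z * gpl p l u xi (x / z)) n.+1.
- by move=> i ni; rewrite ler_pM2r//; apply/ltW/tau_ltS.
- rewrite (gpl_tangent n0 p1 l0 kS (i := i))//; last first.
    by rewrite ler_pdivlMr// ler_pdivrMr.
  rewrite /tangent mulrDr [z * (_ * _)]mulrCA mulrC [x / z]mulrC.
  by rewrite mulVKf ?gt_eqF//; ring.
rewrite tau0 tau_out// => ->; congr EFin.
by rewrite /base_area mulr_suml; apply: eq_bigr => i _; ring.
Qed.

Lemma vol_breveU_base_area : vol_breveU p l u xi = base_area / 3.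
Proof.
rewrite /vol_breveU /vol3.
have volP : ((mu \x mu) \x mu)%E (persp : set (R * R * R)) = (base_area / 3)%:E.
  apply: volume_cone; first exact: persp_measurable.
    exact: area_ysection_persp.
  move=> z z01; apply/seteqP; split=> // -[x y]; rewrite /ysection/= inE.
  by move=> [_ _ h]; rewrite h in z01.
have psub : (persp : set (R * R * R)) `<=` breveU p l u xi.
  by apply: subset_trans (@subset_closure _ _); exact: sub_gen_smallest.
have [U0|U0] := pselect (breveU p l u xi (0, 0, 0)).
  have -> : breveU p l u xi = persp `|` [set (0, 0, 0)].
    by apply/seteqP; split; [exact: breveU_sub|move=> v [/psub//|->]].
  have o1 : [set (0, 0, 0)] = ([set 0] `*` [set 0]) `*` [set 0] :> set (R * R * R).
    by apply/seteqP; split=> [v ->//|[[x y] z] [[/= -> ->] ->]].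
  have m1 : measurable ([set 0] `*` [set 0] : set (R * R)) by exact: measurableX.
  rewrite -[RHS]/(fine (base_area / 3)%:E) -volP; congr fine.
  apply: measureU0; first exact: persp_measurable.
    by rewrite o1; exact: measurableX.
  rewrite o1 [LHS]product_measure1E//.
  exact: etrans (congr1 (mule _) (lebesgue_measure_set1 0)) (mule0 _).
have -> : breveU p l u xi = persp.
  apply/seteqP; split=> // v vU; have [//|vo] := breveU_sub vU.
  by case: U0; rewrite -[(0, 0, 0)]vo.
by rewrite volP.
Qed.

End VolumeOfRelaxation.

(** * The volume as a smooth function of the knots *)

Section ClosedFormOfVolume.
Context {R : realType}.
Variables (p l u : R) (n : nat).
Hypothesis n0 : (0 < n)%N.
Hypotheses (p1 : 1 < p) (l0 : 0 <= l) (lu : l < u).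
Implicit Types xi : 'rV[R]_n.-1.

Definition ordered_knots xi :=
  forall i, (i < n)%N -> knot l u xi i < knot l u xi i.+1.

(** This is tau i.+1 when the knots are ordered, written as a smooth expression
    in the knots with no case distinction on i. *)
Definition node xi i : R := isec p (knot l u xi i) (knot l u xi i.+1).

Definition slope_gap xi i : R :=
  dfpow p (knot l u xi i.+1) - dfpow p (knot l u xi i).

Lemma sum_telescope_pieces (psi : nat -> R -> R) (t : nat -> R) m :
  \sum_(i < m.+1) (psi i (t i.+1) - psi i (t i)) =
  psi m (t m.+1) - psi 0%N (t 0%N) +
  \sum_(i < m) (psi i (t i.+1) - psi i.+1 (t i.+1)).
Proof.
elim: m => [|m ih]; first by rewrite big_ord_recr !big_ord0/= add0r addr0.
by rewrite big_ord_recr ih [in RHS]big_ord_recr/=; ring.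
Qed.

Definition volume_cst : R :=
  let s := secant_slope p l u in
  let F x y := (fpow p l - s * l - (fpow p x - dfpow p x * x)) * y +
    (s - dfpow p x) * y ^+ 2 / 2 in
  (F u u - F l l) / 3.

(** Summation by parts: at tau i.+1 the primitives vanishing at 0 of the
    two tangents meeting there differ by slope_gap * tau ^ 2 / 2. *)
Lemma vol_breveUE xi : ordered_knots xi ->
  vol_breveU p l u xi =
  volume_cst - (\sum_(i < n) slope_gap xi i * node xi i ^+ 2) / 6.
Proof.
move=> kS; rewrite (vol_breveU_base_area n0 p1 l0 lu kS) /base_area.
pose c i := fpow p l - secant_slope p l u * l - tangent_icpt p l u xi i.
pose d i := secant_slope p l u - dfpow p (knot l u xi i).
pose psi i x := c i * x + d i * x ^+ 2 / 2.
pose t := tau p l u xi.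
transitivity ((\sum_(i < n.+1) (psi i (t i.+1) - psi i (t i))) / 3).
  by congr (_ / 3); apply: eq_bigr => i _; rewrite /psi/t/c/d; ring.
rewrite sum_telescope_pieces mulrDl /volume_cst; congr (_ + _).
  rewrite /psi /c /d /t tau0 tau_out// /tangent_icpt knot0 knot_out//.
rewrite !mulr_suml -sumrN; apply: eq_bigr => i _.
have := tangent_diff p1 l0 kS 0 (ltn_ord i).
rewrite /tangent !mulr0 !addr0 sub0r mulrN /node /slope_gap -tauS// -/(t _).
rewrite /psi /c /d => E.
set D := (dfpow _ _ - _) in E *; set T := t _ in E *.
rewrite (_ : tangent_icpt p l u xi i.+1 = tangent_icpt p l u xi i - D * T).
  by rewrite /D; field.
by rewrite -E; ring.
Qed.

End ClosedFormOfVolume.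

(** * Differentials of real functions on a normed space *)

Section DifferentialCalculus.
Context {R : realType} {V : normedModType R}.
Implicit Types (f g df dg : V -> R) (x : V).

Lemma near_eq_is_diff (W : normedModType R) (f g df : V -> W) x :
  (\forall y \near x, f y = g y) -> is_diff x f df -> is_diff x g df.
Proof.
move=> fg fdf; have df_x : differentiable f x by have [] := fdf.
have gx : g \o shift x = cst (g x) + 'd f x +o_ 0 id.
  apply/eqaddoP => e e0.
  have /eqaddoP/(_ e e0) := diff_locally df_x.
  have fgx : f x = g x by exact: nbhs_singleton fg.
  move: fg; rewrite (near_shift 0) subr0 /= => fg fe.
  near=> h; have : (f \o shift x - (cst (f x) + 'd f x)) h =
    (g \o shift x - (cst (g x) + 'd f x)) h.
    rewrite /= ![(_ - _ : _ -> _) _]/(_ - _) /= fgx; congr (_ - _).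
    by near: h; exact: fg.
  move=> <-; near: h; exact: fe.
have d : 'd g x = 'd f x :> (V -> W).
  by apply: diff_unique => //; exact: diff_continuous.
split; last by rewrite d; have [] := fdf.
by apply/diff_locallyP; rewrite d; split=> //; exact: diff_continuous.
Unshelve. all: by end_near. Qed.

Lemma is_diff_subr f g df dg x : is_diff x f df -> is_diff x g dg ->
  is_diff x (fun y => f y - g y) (fun v => df v - dg v).
Proof. by move=> ? ?; exact: is_diffB. Qed.

Lemma is_diff_mulr_fun f g df dg x : is_diff x f df -> is_diff x g dg ->
  is_diff x (fun y => f y * g y) (fun v => f x * dg v + g x * df v).
Proof. by move=> ? ?; exact: is_diffM. Qed.

Lemma is_diff_comp1 (h : R -> R) (h' : R) f df x :
  is_derive (f x) 1 h h' -> is_diff x f df ->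
  is_diff x (fun y => h (f y)) (fun v => h' * df v).
Proof.
move=> hh' fdf.
have hd : is_diff (f x) h (fun r => r * h').
  have [dh eh] := hh'; split; first exact/derivable1_diffP.
  by rewrite deriv1E// derive1E eh.
apply: is_diff_eq (is_diff_comp fdf hd) _.
by apply/funext => v /=; rewrite mulrC.
Qed.

Lemma is_diff_sum (f df : nat -> V -> R) N x :
  (forall i, (i < N)%N -> is_diff x (f i) (df i)) ->
  is_diff x (fun y => \sum_(i < N) f i y) (fun v => \sum_(i < N) df i v).
Proof.
have sumE (h : nat -> V -> R) M :
    (fun y => \sum_(i < M) h i y) = \sum_(i < M) h i.
  by apply/funext => y; rewrite fct_sumE.
rewrite !sumE; elim: N => [_|N ih fdf].
  by rewrite !big_ord0; exact: is_diff_cst.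
rewrite !big_ord_recr/=; apply: is_diffD; last exact: fdf.
by apply: ih => i iN; exact/fdf/ltnW.
Qed.

Lemma is_diff_divr f g df dg x : g x != 0 -> is_diff x f df -> is_diff x g dg ->
  is_diff x (fun y => f y / g y) (fun v => (df v - f x / g x * dg v) / g x).
Proof.
move=> gx fdf gdg.
have iv : is_derive (g x) 1 (@GRing.inv R) (- (g x) ^- 2).
  split; first exact/derivable1_diffP/differentiable_Rinv.
  by rewrite deriveE ?diff_Rinv//; [exact: mulr1|exact: differentiable_Rinv].
apply: is_diff_eq (is_diff_mulr_fun fdf (is_diff_comp1 iv gdg)) _.
by apply/funext => v; field.
Qed.

End DifferentialCalculus.

(** * The gradient of the volume *)

Section GradientOfVolume.
Context {R : realType}.
Variables (p l u : R) (n : nat).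
Hypothesis n0 : (0 < n)%N.
Hypotheses (p1 : 1 < p) (l0 : 0 <= l) (lu : l < u).
Implicit Types x v : 'rV[R]_n.-1.
Local Notation k := (@knot R l u n).
Local Notation T := (@node R p l u n).
Local Notation D := (@slope_gap R p l u n).

(** The knots are affine in the free points and the ends are fixed, so their
    linear part is given by the same list with both ends replaced by 0. *)
Definition dknot v i : R := @knot R 0 0 n v i.

Lemma dknot0 v : dknot v 0 = 0.
Proof. by []. Qed.

Lemma dknot_out v i : (n <= i)%N -> dknot v i = 0.
Proof. exact: knot_out. Qed.

Lemma dknot_coord v (j : 'I_n.-1) : dknot v j.+1 = v 0 j.
Proof. exact: knot_coord. Qed.

Lemma is_diff_knot i x : is_diff x (fun y => k y i) (dknot^~ i).
Proof.
case: i => [|i]; first exact: is_diff_cst.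
have [ni|ni] := ltnP i n.-1; last first.
  have -> : (fun y => k y i.+1) = cst u.
    by apply/funext => y; rewrite knot_out// -(prednK n0).
  have -> : dknot^~ i.+1 = 0.
    by apply/funext => y; rewrite dknot_out// -(prednK n0).
  exact: is_diff_cst.
pose j := Ordinal ni.
have -> : (fun y => k y i.+1) = (fun y => y 0 j).
  by apply/funext => y; exact: (knot_coord _ _ y j).
have -> : dknot^~ i.+1 = (fun y => y 0 j).
  by apply/funext => y; exact: (knot_coord _ _ y j).
have @f : {linear 'rV[R]_n.-1 -> R}.
  by exists (fun N : 'rV[R]_n.-1 => N 0 j); do 2![eexists]; do ?[constructor];
     rewrite ?mxE// => ? *; rewrite ?mxE//; move=> ?; rewrite !mxE.
have cf : continuous f by exact: coord_continuous.
rewrite -[fun y => _]/(f : _ -> _).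
split; first exact: linear_differentiable.
by rewrite diff_lin.
Qed.

(** For i = 0 the knot may be 0, where h need not be differentiable, but it is
    constant. *)
Lemma is_diff_knot_comp (h h' : R -> R) i x :
  ordered_knots l u x -> (i <= n)%N ->
  (forall r : R, 0 < r -> is_derive r 1 h (h' r)) ->
  is_diff x (fun y => h (k y i)) (fun v => h' (k x i) * dknot v i).
Proof.
move=> kS ni hh'; case: i ni => [_|i ni].
  apply: is_diff_eq (is_diff_cst (h l) x) _.
  by apply/funext => v; rewrite dknot0 mulr0.
by apply: is_diff_comp1 (is_diff_knot _ _); apply: hh'; exact: knot_gt0.
Qed.

Lemma slope_gap_gt0 x i : ordered_knots l u x -> (i < n)%N -> 0 < D x i.
Proof. by move=> kS; exact: tangent_slope_gt0. Qed.

(** The differential of an intersection abscissa, as found by implicit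
    differentiation of the equation of the two tangents. *)
Definition dnode x v i : R :=
  (d2fpow p (k x i) * (T x i - k x i) * dknot v i +
   d2fpow p (k x i.+1) * (k x i.+1 - T x i) * dknot v i.+1) / D x i.

Lemma is_diff_slope_gap x i : ordered_knots l u x -> (i < n)%N ->
  is_diff x (fun y => D y i)
    (fun v => d2fpow p (k x i.+1) * dknot v i.+1 - d2fpow p (k x i) * dknot v i).
Proof.
move=> kS ni; apply: is_diff_subr; apply: is_diff_knot_comp => //.
- by move=> r; exact: is_derive_dfpow.
- exact: ltnW.
- by move=> r; exact: is_derive_dfpow.
Qed.

Lemma is_diff_node x i : ordered_knots l u x -> (i < n)%N ->
  is_diff x (fun y => T y i) (fun v => dnode x v i).
Proof.
move=> kS ni.
have Df : is_diff x (fun y => fpow p (k y i.+1) - fpow p (k y i))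
    (fun v => dfpow p (k x i.+1) * dknot v i.+1 - dfpow p (k x i) * dknot v i).
  by apply: is_diff_subr; apply: is_diff_knot_comp => //; exact: ltnW.
have DN := is_diff_mulr_fun (is_diff_cst (p - 1) x) Df.
have D0 : D x i != 0 by rewrite gt_eqF// slope_gap_gt0.
have := is_diff_divr (g := fun y => D y i) D0 DN (is_diff_slope_gap kS ni).
move=> /is_diff_eq; apply; apply/funext => v.
rewrite /dnode /cst/= mulr0 addr0; congr (_ / _).
rewrite -/(isec p (k x i) (k x i.+1)) -/(T x i).
have E0 := d2fpow_mul p1 (knot_ge0 l0 kS (ltnW ni)).
have E1 := d2fpow_mul p1 (knot_ge0 l0 kS ni).
transitivity ((p - 1) * dfpow p (k x i.+1) * dknot v i.+1 -
  (p - 1) * dfpow p (k x i) * dknot v i -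
  T x i * (d2fpow p (k x i.+1) * dknot v i.+1 - d2fpow p (k x i) * dknot v i)).
  by ring.
by rewrite -E0 -E1; ring.
Qed.

(** The differential of slope_gap * node ^ 2: the denominators of dnode cancel
    against slope_gap. *)
Definition dvol_term x v i : R :=
  d2fpow p (k x i.+1) * (2 * T x i * k x i.+1 - T x i ^+ 2) * dknot v i.+1 +
  d2fpow p (k x i) * (T x i ^+ 2 - 2 * k x i * T x i) * dknot v i.

Lemma is_diff_volume_sum x : ordered_knots l u x ->
  is_diff x (fun y => \sum_(i < n) D y i * T y i ^+ 2)
    (fun v => \sum_(i < n) dvol_term x v i).
Proof.
move=> kS; apply: (@is_diff_sum _ _ (fun i y => D y i * T y i ^+ 2)
  (fun i v => dvol_term x v i)) => i ni.
have DT := is_diff_node kS ni.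
have := is_diff_mulr_fun (is_diff_slope_gap kS ni) (is_diff_mulr_fun DT DT).
move=> /is_diff_eq; apply; apply/funext => v.
have D0 : D x i != 0 by rewrite gt_eqF// slope_gap_gt0.
by rewrite /dvol_term /dnode; field.
Qed.

(** Regroups contributions of the pieces into contributions of the free knots;
    it serves for the gradient, where z is linear in the direction, and for the
    Hessian, where z may be quadratic. *)
Lemma sum_pieces_knots (A B z : nat -> R) : z 0%N = 0 -> z n = 0 ->
  \sum_(i < n) (A i * z i + B i * z i.+1) =
  \sum_(j < n.-1) (A j.+1 + B j) * z j.+1.
Proof.
move=> z0; case: n n0 => // m _ zm.
rewrite big_split/= big_ord_recl/= z0 mulr0 add0r.
rewrite [X in _ + X]big_ord_recr/= zm mulr0 addr0 -big_split/=.
by apply: eq_bigr => i _; rewrite mulrDl.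
Qed.

(** Up to the factor -1/6, the partial derivative along the j-th free point is
    grad_weight * grad_factor.  The weight is positive, and the factor vanishes
    exactly when the knot j.+1 is the midpoint of the adjacent nodes. *)
Definition grad_factor x j : R := T x j.+1 + T x j - 2 * k x j.+1.

Definition grad_weight x j : R := d2fpow p (k x j.+1) * (T x j.+1 - T x j).

Lemma sum_dvol_term x v : \sum_(i < n) dvol_term x v i =
  \sum_(j < n.-1) grad_weight x j * grad_factor x j * v 0 j.
Proof.
rewrite /dvol_term; under eq_bigr do rewrite addrC.
rewrite (@sum_pieces_knots
  (fun i => d2fpow p (k x i) * (T x i ^+ 2 - 2 * k x i * T x i))
  (fun i => d2fpow p (k x i.+1) * (2 * T x i * k x i.+1 - T x i ^+ 2))
  (dknot v))// ?dknot_out//.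
apply: eq_bigr => j _; rewrite dknot_coord /grad_weight /grad_factor; ring.
Qed.

Lemma ordered_knots_near x : ordered_knots l u x ->
  \forall y \near x, ordered_knots l u y.
Proof.
move=> kS; have : \forall y \near x, forall i : 'I_n, k y i < k y i.+1.
  apply: (@filter_forall _ _ (fun (i : 'I_n) y => k y i < k y i.+1)
    (nbhs x) _) => i.
  have c : {for x, continuous (fun y => k y i.+1 - k y i)}.
    apply: differentiable_continuous.
    by have [] := is_diff_subr (is_diff_knot i.+1 x) (is_diff_knot i x).
  near=> y; rewrite -subr_gt0; near: y.
  by apply: (c [set r | 0 < r]); apply: lt_nbhsr; rewrite subr_gt0 kS.
by apply: filterS => y h i ni; exact: (h (Ordinal ni)).
Unshelve. all: by end_near. Qed.

Local Notation vol := (fun y : 'rV[R]_n.-1 => vol_breveU p l u y).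

Lemma is_diff_vol x : ordered_knots l u x ->
  is_diff x vol (fun v =>
    - (\sum_(j < n.-1) grad_weight x j * grad_factor x j * v 0 j) / 6).
Proof.
move=> kS; apply: (@near_eq_is_diff _ _ _ (fun y => volume_cst p l u -
    (\sum_(i < n) D y i * T y i ^+ 2) * 6^-1)).
  near=> y; rewrite vol_breveUE//; near: y; exact: ordered_knots_near.
have := is_diff_subr (is_diff_cst (volume_cst p l u) x)
  (is_diff_mulr_fun (is_diff_volume_sum kS) (is_diff_cst (6^-1 : R) x)).
move=> /is_diff_eq; apply; apply/funext => v; rewrite sum_dvol_term /cst/=.
by rewrite mulr0 !add0r mulNr mulrC.
Unshelve. all: by end_near. Qed.

Lemma partial_vol x j : ordered_knots l u x ->
  'D_('e_j) vol x = - (grad_weight x j * grad_factor x j) / 6.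
Proof.
move=> /is_diff_vol [dV eV]; rewrite deriveE// eV/=; congr (- _ / _).
rewrite (bigD1 j)//= !mxE !eqxx mulr1 big1 ?addr0// => i ij.
by rewrite !mxE eqxx (negbTE ij) mulr0.
Qed.

End GradientOfVolume.

(** * The Hessian at a critical point *)

Section Hessian.
Context {R : realType}.
Variables (p l u : R) (n : nat).
Hypothesis n0 : (0 < n)%N.
Hypotheses (p1 : 1 < p) (l0 : 0 <= l) (lu : l < u).
Variable x : 'rV[R]_n.-1.
Hypothesis kS : ordered_knots l u x.
Hypothesis crit : forall j, (j < n.-1)%N -> grad_factor p l u x j = 0.
Implicit Types v w : 'rV[R]_n.-1.
Local Notation k := (knot l u x).
Local Notation T := (node p l u x).
Local Notation D := (slope_gap p l u x).
Local Notation vol := (fun y : 'rV[R]_n.-1 => vol_breveU p l u y).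

Let ltn_free j : (j < n.-1)%N -> (j.+1 < n)%N.
Proof. by move=> jn; rewrite -(prednK n0). Qed.

Definition dgrad_factor v j : R :=
  dnode p l u x v j.+1 + dnode p l u x v j - 2 * dknot v j.+1.

Lemma is_diff_grad_factor j : (j < n.-1)%N ->
  is_diff x (fun y : 'rV[R]_n.-1 => grad_factor p l u y j) (dgrad_factor^~ j).
Proof.
move=> /ltn_free jn.
have d1 := is_diff_node n0 p1 l0 kS jn.
have d0 := is_diff_node n0 p1 l0 kS (ltnW jn).
have := is_diff_subr (is_diffD d1 d0)
  (is_diff_mulr_fun (is_diff_cst (2 : R) x) (is_diff_knot l u n0 j.+1 x)).
move=> /is_diff_eq; apply; apply/funext => v.
by rewrite /dgrad_factor /cst/= mulr0 addr0.
Qed.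

Lemma is_derive_d2fpow (r : R) : 0 < r ->
  is_derive r 1 (d2fpow p) (p * (p - 1) * ((p - 2) * r `^ (p - 2 - 1))).
Proof.
move=> r0.
have h : is_derive r 1 (@powR R^~ (p - 2)) ((p - 2) * r `^ (p - 2 - 1)).
  exact: is_derive1_powR.
have -> : d2fpow p = (p * (p - 1)) \*: @powR R^~ (p - 2) by [].
exact: (@is_deriveZ R R R).
Qed.

Lemma grad_weight_differentiable j : (j < n.-1)%N ->
  exists dW, is_diff x (fun y : 'rV[R]_n.-1 => grad_weight p l u y j) dW.
Proof.
move=> /ltn_free jn.
have d2 := is_diff_knot_comp n0 l0 kS (ltnW jn) is_derive_d2fpow.
have d1 := is_diff_node n0 p1 l0 kS jn.
have d0 := is_diff_node n0 p1 l0 kS (ltnW jn).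
by eexists; exact: is_diff_mulr_fun d2 (is_diff_subr d1 d0).
Qed.

(** At a critical point the second factor of each partial derivative vanishes,
    so that only its differential contributes. *)
Lemma is_diff_partial j : (j < n.-1)%N ->
  is_diff x (fun y : 'rV[R]_n.-1 =>
      - (grad_weight p l u y j * grad_factor p l u y j) / 6)
    (fun v => - (grad_weight p l u x j * dgrad_factor v j) / 6).
Proof.
move=> jn; have [dW hW] := grad_weight_differentiable jn.
have hP := is_diff_mulr_fun hW (is_diff_grad_factor jn).
have := is_diff_mulr_fun (is_diff_cst (- 6^-1 : R) x) hP.
have -> : (fun y => cst (- 6^-1 : R) y *
      (grad_weight p l u y j * grad_factor p l u y j)) =
    (fun y : 'rV[R]_n.-1 => - (grad_weight p l u y j * grad_factor p l u y j) / 6).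
  by apply/funext => y; rewrite /cst; ring.
move=> /is_diff_eq; apply; apply/funext => v.
rewrite /cst/= crit// mulr0 mul0r !addr0; ring.
Qed.

Lemma partial_vol_near (j : 'I_n.-1) : \forall y \near x,
  'D_('e_j) vol y = - (grad_weight p l u y j * grad_factor p l u y j) / 6.
Proof.
apply: filterS (ordered_knots_near n0 kS) => y yS.
exact: (partial_vol n0 p1 l0 lu).
Qed.

Lemma vol_twice_differentiable : twice_differentiable vol x.
Proof.
split.
  apply: filterS (ordered_knots_near n0 kS) => y yS.
  by have [] := is_diff_vol n0 p1 l0 lu yS.
pose G (y : 'rV[R]_n.-1) : 'rV[R]_n.-1 := \sum_(j < n.-1)
  (- (grad_weight p l u y j * grad_factor p l u y j) / 6) *: 'e_j.
have dG : differentiable G x.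
  have -> : G = \sum_(j < n.-1) (fun y : 'rV[R]_n.-1 =>
      (- (grad_weight p l u y j * grad_factor p l u y j) / 6) *: 'e_j).
    by apply/funext => y; rewrite fct_sumE.
  apply: differentiable_sum => j; apply: differentiableZl.
  by have [] := is_diff_partial (ltn_ord j).
have : is_diff x (gradient vol) ('d G x).
  apply: (near_eq_is_diff (f := G)); last exact: DiffDef.
  have : \forall y \near x, forall j : 'I_n.-1, 'D_('e_j) vol y =
      - (grad_weight p l u y j * grad_factor p l u y j) / 6.
    by apply: (@filter_forall _ _ (fun (j : 'I_n.-1) y => 'D_('e_j) vol y =
      - (grad_weight p l u y j * grad_factor p l u y j) / 6) (nbhs x) _) => j;
      exact: partial_vol_near.
  apply: filterS => y h; apply/rowP => j; rewrite /G summxE !mxE h.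
  rewrite (bigD1 j)//= big1 ?addr0; last first.
    by move=> i ij; rewrite !mxE eqxx eq_sym (negbTE ij) mulr0.
  by rewrite !mxE !eqxx mulr1.
by case.
Qed.

Lemma hessian_volE (i j : 'I_n.-1) : hessian vol x i j =
  - (grad_weight p l u x j * dgrad_factor 'e_i j) / 6.
Proof.
rewrite mxE (near_eq_derive 'e_i (partial_vol_near j)).
by have [dG eG] := is_diff_partial (ltn_ord j); rewrite deriveE// eG.
Qed.

(** The Hessian as a bilinear form, up to the factor -1/6. *)
Definition hess_form v w : R :=
  \sum_(j < n.-1) grad_weight p l u x j * dgrad_factor v j * w 0 j.

Lemma nodeS_crit j : (j < n.-1)%N -> T j.+1 = 2 * k j.+1 - T j.
Proof. by move=> /crit; rewrite /grad_factor; lra. Qed.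

(** In this form the Hessian is visibly symmetric: D i * dnode collects the
    contributions of both ends of piece i. *)
Lemma hess_formE v w : hess_form v w =
  2 * (\sum_(i < n) D i * dnode p l u x v i * dnode p l u x w i) -
  4 * (\sum_(j < n.-1)
    d2fpow p (k j.+1) * (k j.+1 - T j) * v 0 j * w 0 j).
Proof.
have -> : \sum_(i < n) D i * dnode p l u x v i * dnode p l u x w i =
    \sum_(i < n) (
      dnode p l u x v i * (d2fpow p (k i) * (T i - k i)) * dknot w i +
      dnode p l u x v i * (d2fpow p (k i.+1) * (k i.+1 - T i)) * dknot w i.+1).
  apply: eq_bigr => i _; have D0 : D i != 0.
    by rewrite gt_eqF// slope_gap_gt0.
  by rewrite {2}/dnode; field.
rewrite (@sum_pieces_knots _ _ n0
  (fun i => dnode p l u x v i * (d2fpow p (k i) * (T i - k i)))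
  (fun i => dnode p l u x v i * (d2fpow p (k i.+1) * (k i.+1 - T i)))
  (dknot w))// ?dknot_out//.
rewrite !mulr_sumr -sumrB; apply: eq_bigr => j _.
by rewrite /grad_weight /dgrad_factor !dknot_coord// nodeS_crit//; ring.
Qed.

Lemma hess_formC v w : hess_form v w = hess_form w v.
Proof.
rewrite !hess_formE; congr (2 * _ - 4 * _); apply: eq_bigr => i _; ring.
Qed.

Section NegativeDefinite.
Variable v : 'rV[R]_n.-1.
(* The direction v is measured relative to the scaling direction (the knots
   themselves), along which the critical equations are homogeneous. *)
Let s i : R := dknot v i / k i.
Let a i : R := d2fpow p (k i) * k i * (T i - k i).
Let b i : R := d2fpow p (k i.+1) * k i.+1 * (k i.+1 - T i).

Let s0 : s 0%N = 0. Proof. by rewrite /s dknot0 mul0r. Qed.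
Let sn : s n = 0. Proof. by rewrite /s dknot_out// mul0r. Qed.

Let k_gt0 i : (0 < i <= n)%N -> 0 < k i.
Proof. exact: knot_gt0. Qed.

Let T_between i : (i < n)%N -> k i < T i < k i.+1.
Proof.
move=> ni; apply: isec_between => //; last exact: kS.
exact/(knot_ge0 l0 kS)/ltnW.
Qed.

Let a_gt0 i : (0 < i < n)%N -> 0 < a i.
Proof.
move=> /andP[i0 ni]; have ki : 0 < k i by rewrite k_gt0// i0 ltnW.
apply: mulr_gt0; last by rewrite subr_gt0; case/andP: (T_between ni).
by rewrite mulr_gt0 ?d2fpow_gt0.
Qed.

Let a_ge0 i : (i < n)%N -> 0 <= a i.
Proof.
case: i => [_|i ni]; last by rewrite ltW// a_gt0.
rewrite /a mulr_ge0//; last by rewrite subr_ge0 ltW//; case/andP: (T_between n0).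
by rewrite d2fpow_mul// mulr_ge0 ?dfpow_ge0// subr_ge0 ltW.
Qed.

Let b_gt0 i : (i < n)%N -> 0 < b i.
Proof.
move=> ni; have ki : 0 < k i.+1 by exact: k_gt0.
apply: mulr_gt0; last by rewrite subr_gt0; case/andP: (T_between ni).
by rewrite mulr_gt0 ?d2fpow_gt0.
Qed.

Let ab i : (i < n)%N -> a i + b i = T i * D i.
Proof.
move=> ni; apply: isec_euler => //; last exact: kS.
exact/(knot_ge0 l0 kS)/ltnW.
Qed.

Let dknotE i : (i <= n)%N -> dknot v i = k i * s i.
Proof.
case: i => [_|i ni]; first by rewrite s0 mulr0 dknot0.
by rewrite /s mulrC divfK// gt_eqF// k_gt0.
Qed.

(** By Euler's relation the Cauchy-Schwarz defect of each piece, with weights a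
    and b, is a square. *)
Lemma hess_form_sum_squares : hess_form v v =
  - 2 * \sum_(i < n) a i * b i * (s i - s i.+1) ^+ 2 / D i.
Proof.
rewrite hess_formE.
have -> : 4 * (\sum_(j < n.-1)
      d2fpow p (k j.+1) * (k j.+1 - T j) * v 0 j * v 0 j) =
    2 * \sum_(i < n) (T i * a i * s i ^+ 2 + T i * b i * s i.+1 ^+ 2).
  rewrite (@sum_pieces_knots _ _ n0 (fun i => T i * a i) (fun i => T i * b i)
    (fun i => s i ^+ 2)) ?s0 ?sn ?expr0n//.
  rewrite !mulr_sumr; apply: eq_bigr => j _.
  rewrite -!dknot_coord// dknotE; last exact/ltnW/ltn_free.
  by rewrite /a /b nodeS_crit//; ring.
rewrite -mulrBr -sumrB mulNr -mulrN -sumrN; congr (_ * _).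
apply: eq_bigr => i _; have D0 : D i != 0 by rewrite gt_eqF// slope_gap_gt0.
have TE : T i = (a i + b i) / D i by rewrite ab// mulfK.
have -> : dnode p l u x v i = (a i * s i + b i * s i.+1) / D i.
  by rewrite /dnode !dknotE ?(ltnW (ltn_ord i))// /a /b; congr (_ / _); ring.
by rewrite TE; field.
Qed.

Lemma hess_form_lt0 : v != 0 -> hess_form v v < 0.
Proof.
move=> v0; rewrite hess_form_sum_squares mulNr oppr_lt0 mulr_gt0//.
have ge0 i : (i < n)%N -> 0 <= a i * b i * (s i - s i.+1) ^+ 2 / D i.
  move=> ni; rewrite divr_ge0 ?(ltW (slope_gap_gt0 p1 l0 kS ni))//.
  by rewrite mulr_ge0 ?sqr_ge0// mulr_ge0 ?a_ge0// ltW// b_gt0.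
rewrite lt0r sumr_ge0 ?andbT; last by move=> i _; exact: ge0.
apply: contra_neq v0 => /psumr_eq0P sum0.
have sS i : (0 < i < n)%N -> s i = s i.+1.
  move=> /[dup] i0n /andP[i0 ni].
  have := sum0 (fun j _ => ge0 j (ltn_ord j)) (Ordinal ni) isT => /= /eqP.
  move: (slope_gap_gt0 p1 l0 kS ni) (a_gt0 i0n) (b_gt0 ni).
  move: (D i) (a i) (b i) (s i) (s i.+1) => d A B y z d0 A0 B0.
  rewrite mulf_eq0 invr_eq0 (gt_eqF d0) orbF mulf_eq0 mulf_eq0.
  rewrite (gt_eqF A0) (gt_eqF B0) /=.
  by rewrite sqrf_eq0 subr_eq0 => /eqP.
have sB d : (d < n)%N -> s (n - d)%N = 0.
  elim: d => [_|d ih dn]; first by rewrite subn0 sn.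
  rewrite sS; first by rewrite subnSK ?(ltnW dn)// ih// ltnW.
  by rewrite subn_gt0 dn ltn_subrL n0.
apply/rowP => j; rewrite mxE -dknot_coord// dknotE; last exact/ltnW/ltn_free.
have jn := ltn_free (ltn_ord j).
by rewrite -(subKn (ltnW jn)) sB ?mulr0// ltn_subrL n0.
Qed.

End NegativeDefinite.

Lemma hessian_row_mul v (j : 'I_n.-1) :
  \sum_(i < n.-1) v 0 i * hessian vol x i j =
  - (grad_weight p l u x j * dgrad_factor v j) / 6.
Proof.
have [dG eG] := is_diff_partial (ltn_ord j).
have e w : - (grad_weight p l u x j * dgrad_factor w j) / 6 =
    'd (fun y : 'rV[R]_n.-1 =>
      - (grad_weight p l u y j * grad_factor p l u y j) / 6) x w.
  by rewrite eG.
rewrite e [in RHS](row_sum_delta v) linear_sum; apply: eq_bigr => i _.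
by rewrite hessian_volE e linearZ.
Qed.

Lemma hessian_vol_positive_definite : positive_definite (hessian vol x).
Proof.
split.
  apply/matrixP => i j; rewrite mxE !hessian_volE; congr (- _ / _).
  have delta w (i' : 'I_n.-1) : hess_form w 'e_i' =
      grad_weight p l u x i' * dgrad_factor w i'.
    rewrite /hess_form (bigD1 i')//= big1 ?addr0; last first.
      by move=> h hi; rewrite !mxE eqxx (negbTE hi) mulr0.
    by rewrite !mxE !eqxx mulr1.
  by rewrite -!delta hess_formC.
move=> v v0; rewrite mxE.
suff -> : \sum_j (v *m hessian vol x) 0 j * v^T j 0 = - hess_form v v / 6.
  by rewrite divr_gt0// oppr_gt0 hess_form_lt0.
rewrite /hess_form mulNr mulr_suml -sumrN; apply: eq_bigr => j _.
by rewrite !mxE hessian_row_mul; ring.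
Qed.

End Hessian.

Theorem theorem3p4 (R : realType) (p l u : R) (n : nat) (xi : 'rV[R]_n.-1)
    (hl : 0 <= l) (hlu : l < u) (hp : 1 < p) (hn : (2 <= n)%N)
    (hxi : forall i : nat, (i < n)%N -> knot l u xi i < knot l u xi i.+1)
    (hcrit : gradient (fun x : 'rV[R]_n.-1 => vol_breveU p l u x) xi = 0) :
  twice_differentiable (fun x : 'rV[R]_n.-1 => vol_breveU p l u x) xi /\
  positive_definite (hessian (fun x : 'rV[R]_n.-1 => vol_breveU p l u x) xi).
Proof.
have n0 : (0 < n)%N by exact: ltnW.
have crit j : (j < n.-1)%N -> grad_factor p l u xi j = 0.
  move=> jn; have j1n : (j.+1 < n)%N by rewrite -(prednK n0).
  have := congr1 (fun g : 'rV[R]_n.-1 => g 0 (Ordinal jn)) hcrit.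
  rewrite !mxE (partial_vol n0 hp hl hlu _ hxi)/= => /eqP.
  rewrite mulf_eq0 invr_eq0 pnatr_eq0 orbF oppr_eq0 mulf_eq0.
  move=> /predU1P[|/eqP//].
  move/eqP; rewrite mulf_eq0 subr_eq0 !gt_eqF//.
    have /andP[_ h1] := isec_between hp
      (knot_ge0 hl hxi (ltnW (ltnW j1n))) (hxi _ (ltnW j1n)).
    have /andP[h2 _] := isec_between hp
      (knot_ge0 hl hxi (ltnW j1n)) (hxi _ j1n).
    exact: lt_trans h1 h2.
  by apply: d2fpow_gt0 => //; apply: (knot_gt0 hl hxi); rewrite /= ltnW.
split; first exact: vol_twice_differentiable.
exact: hessian_vol_positive_definite.
Qed.
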